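(* Let $f(\mathbf{x})=\frac12\mathbf{x}^\top A\mathbf{x}+b^\top\mathbf{x}+c$ for $\mathbf{x}\in\mathbb{R}^d$, where $A\in\mathbb{R}^{d\times d}$ is symmetric positive definite, $b\in\mathbb{R}^d$, $c\in\mathbb{R}$, and let $\mathbf{x}^*=-A^{-1}b$ be its unique minimizer. For $\alpha\in(0,1)$, $\beta\in\mathbb{R}$ and an integer $L\ge1$, let $\gamma_{\alpha,\beta}=\beta-\frac{1-\alpha}{2-\alpha}$ and let $\{\mathbf{x}^{(-j)}\}_{j=0}^L\subset\mathbb{R}^d$ be initial points. Consider the Caputo fractional gradient descent iteration $\mathbf{x}^{(k+1)}=\mathbf{x}^{(k)}-\eta_k\vec{\mathbf{d}}_k$, $k=0,1,\dots$, applied to $f$ with $\alpha_k=\alpha$, $\beta_k=\beta$, $\eta_k=\eta$ and $\mathbf{c}_k=\mathbf{x}^{(k-L)}$ for all $k$, where $\eta>0$. Then the $k$-th iterate ($k\ge1$) satisfies $$\|\mathbf{x}^{(k)}-\mathbf{x}^*\|\le\sum_{j=0}^L\|\mathcal{A}_{k,j}\|\,\|\mathbf{x}^{(-j)}-\mathbf{x}^*\|,$$ where the matrices $\mathcal{A}_{k,j}\in\mathbb{R}^{d\times d}$ are defined recursively by $$\mathcal{A}_{k,0}=\mathcal{A}_{k-1,0}\mathcal{A}_{1,0}+\mathcal{A}_{k-1,1},\qquad \mathcal{A}_{k,L}=\mathcal{A}_{k-1,0}\mathcal{A}_{1,L},\qquad \mathcal{A}_{k,j}=\mathcal{A}_{k-1,j+1}\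 \ (1\le j<L),$$ for $k=2,3,\dots$, starting with $\mathcal{A}_{1,0}=I-\eta(A+\gamma_{\alpha,\beta}\,\mathrm{diag}(A))$, $\mathcal{A}_{1,L}=\eta\,\gamma_{\alpha,\beta}\,\mathrm{diag}(A)$ and $\mathcal{A}_{1,j}=0$ for $1\le j<L$, and $\|\mathcal{A}_{k,j}\|$ is the spectral norm. Furthermore, if $\lim_{k\to\infty}\|\mathcal{A}_{k,0}\|=0$, then $$\lim_{k\to\infty}\|\mathbf{x}^{(k)}-\mathbf{x}^*\|=0.$$
   Context: For vectors $\|\cdot\|$ is the Euclidean norm. In the matrices $\mathcal A_{1,0}$, $I$ is the $d\times d$ identity matrix, and $\mathrm{diag}(A)$ is the diagonal matrix with the diagonal entries of $A$. Caputo fractional derivatives. Let $\nu\in(n-1,n)$ with $n\in\mathbb{N}$, and let $c\in\mathbb{R}$. For $x>c$, ${}_{c}^{C}D_x^{\nu} g(x)=\frac{1}{\Gamma(n-\nu)}\int_c^x \frac{g^{(n)}(t)}{(x-t)^{\nu-n+1}}\,dt$ (left Caputo derivative). For $x<c$, the same symbol is understood as the right Caputo derivative ${}_{c}^{C}D_x^{\nu} g(x)=\frac{(-1)^n}{\Gamma(n-\nu)}\int_x^c \frac{g^{(n)}(t)}{(t-x)^{\nu-n+1}}\,dt$. Caputo fractional gradient. For $\mathbf{x}=(x_j)\in\mathbb{R}^d$ put $f_{j,\mathbf{x}}(t)=f(\mathbf{x}+(t-x_j)e_j)$, with $e_j$ the $j$-th standard basis vector. For $\mathbf{c}=(c_j)\in\mathbb{R}^d$,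 ${}_{\mathbf{c}}^{C}\nabla_{\mathbf{x}}^{\nu} f(\mathbf{x})\in\mathbb{R}^d$ is the vector whose $j$-th component is ${}_{c_j}^{C}D_x^{\nu} f_{j,\mathbf{x}}$ evaluated at $x_j$. Caputo fractional gradient descent (CFGD). With $\mathbf{x}^{(k)}=(x_j^k)$, $\mathbf{c}_k=(c_j^k)$, $\alpha_k\in(0,1)$, $\beta_k\in\mathbb{R}$, learning rate $\eta_k$, the iteration is $\mathbf{x}^{(k+1)}=\mathbf{x}^{(k)}-\eta_k\vec{\mathbf{d}}_k$, where $$\vec{\mathbf{d}}_k = \mathrm{diag}\big({}_{c_j^k}^{C}D^{\alpha_k}_{x} \iota(x^k_j)\big)^{-1}\Big[ {}_{\mathbf{c}_k}^{C}\nabla^{\alpha_k}_{\mathbf{x}} f(\mathbf{x}^{(k)})+\beta_k\, \mathrm{diag}\big(|x^k_j-c^k_j|\big)\; {}_{\mathbf{c}_k}^{C}\nabla^{1+\alpha_k}_{\mathbf{x}} f(\mathbf{x}^{(k)})\Big],$$ $\iota(x)=x$ is the identity map on $\mathbb{R}$, and $\mathrm{diag}(v_j)$ is the diagonal matrix with entries $v_j$. It is assumed that the iteration is well defined, i.e. $x_j^k\neq c_j^k$ for all $j$ and all $k\ge 0$. *)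

(* Defs.v *)
From HB Require Import structures.
From mathcomp Require Import all_boot all_order all_algebra.
From mathcomp Require Import all_classical all_reals all_analysis.

Set Implicit Arguments.
Unset Strict Implicit.
Unset Printing Implicit Defensive.

Import Order.TTheory GRing.Theory Num.Theory.
Import numFieldNormedType.Exports.

Local Open Scope classical_set_scope.
Local Open Scope ring_scope.

Section Matrices.
Context {R : realType}.

(* The library norm on matrices is the max norm of the entries, hence
   these definitions. *)
Definition enorm {d : nat} (v : 'cV[R]_d) : R :=
  Num.sqrt (\sum_(i < d) v i 0 ^+ 2).

(* Operator norm induced by [enorm]. *)
Definition spectral_norm {d : nat} (M : 'M[R]_d) : R :=
  sup [set enorm (M *m v) | v in [set v : 'cV[R]_d | enorm v <= 1]].

Definition sym_posdef {d : nat} (A : 'M[R]_d) : Prop :=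
  A^T = A /\ forall v : 'cV[R]_d, v != 0 -> 0 < (v^T *m A *m v) 0 0.

Definition diag_part {d : nat} (A : 'M[R]_d) : 'M[R]_d :=
  diag_mx (\row_(i < d) A i i).

Definition quadratic {d : nat} (A : 'M[R]_d) (b : 'cV[R]_d) (c : R)
    (x : 'cV[R]_d) : R :=
  2^-1 * (x^T *m A *m x) 0 0 + (b^T *m x) 0 0 + c.

End Matrices.

Section Caputo.
Context {R : realType}.

(* Euler's Gamma function; only meaningful for [0 < z]. *)
Definition Gamma (z : R) : R :=
  \int[lebesgue_measure]_(t in `]0, +oo[) (t `^ (z - 1) * expR (- t)).

(* Caputo derivative of order [nu], for positive noninteger [nu]: [n] is the
   natural number with [n - 1 < nu < n].  It is the left derivative if
   [c < x] and the right derivative if [x < c]; the value at [x = c] is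
   irrelevant.  The singularity of the kernel at [t = x] is a null set, where
   [powR] and inversion take the dummy value 0. *)
Definition caputo (nu c : R) (g : R -> R) (x : R) : R :=
  let n := (Num.truncn nu).+1 in
  if c < x then
    (Gamma (n%:R - nu))^-1 *
      \int[lebesgue_measure]_(t in `[c, x])
        (derive1n n g t / (x - t) `^ (nu - n%:R + 1))
  else
    (-1) ^+ n / Gamma (n%:R - nu) *
      \int[lebesgue_measure]_(t in `[x, c])
        (derive1n n g t / (t - x) `^ (nu - n%:R + 1)).

Definition coord_line {d : nat} (f : 'cV[R]_d -> R) (j : 'I_d)
    (x : 'cV[R]_d) (t : R) : R :=
  f (x + (t - x j 0) *: delta_mx j 0).

Definition caputo_grad {d : nat} (nu : R) (c : 'cV[R]_d)
    (f : 'cV[R]_d -> R) (x : 'cV[R]_d) : 'cV[R]_d :=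
  \col_(j < d) caputo nu (c j 0) (coord_line f j x) (x j 0).

Definition cfgd_dir {d : nat} (f : 'cV[R]_d -> R) (alpha beta : R)
    (c x : 'cV[R]_d) : 'cV[R]_d :=
  invmx (diag_mx (\row_(j < d) caputo alpha (c j 0) id (x j 0))) *m
  (caputo_grad alpha c f x +
   beta *: (diag_mx (\row_(j < d) `|x j 0 - c j 0|) *m
            caputo_grad (1 + alpha) c f x)).

(* The iterates are indexed by [int] so that negative indices can hold the
   initial points of a method whose terminals [c] are earlier iterates. *)
Definition cfgd {d : nat} (f : 'cV[R]_d -> R) (alpha beta eta : nat -> R)
    (c : nat -> 'cV[R]_d) (x : int -> 'cV[R]_d) : Prop :=
  forall k : nat,
    x k.+1%:Z =
    x k%:Z - eta k *: cfgd_dir f (alpha k) (beta k) (c k) (x k%:Z).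

Definition cfgd_well_defined {d : nat} (c : nat -> 'cV[R]_d)
    (x : int -> 'cV[R]_d) : Prop :=
  forall (k : nat) (j : 'I_d), x k%:Z j 0 != c k j 0.

End Caputo.

Section Recursion.
Context {R : realType}.

Definition cfgd_gamma (alpha beta : R) : R :=
  beta - (1 - alpha) / (2 - alpha).

Definition cfgd_mx1 {d : nat} (A : 'M[R]_d) (eta gamma : R) (L j : nat) :
    'M[R]_d :=
  if j == 0%N then 1%:M - eta *: (A + gamma *: diag_part A)
  else if j == L then (eta * gamma) *: diag_part A
  else 0.

(* Meaningful for [1 <= k] and [j <= L]; the value at [k = 0] is a dummy. *)
Fixpoint cfgd_mx {d : nat} (A : 'M[R]_d) (eta gamma : R) (L k j : nat) :
    'M[R]_d :=
  match k with
  | 0%N => 0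
  | 1%N => cfgd_mx1 A eta gamma L j
  | k'.+1 =>
    let M := cfgd_mx A eta gamma L k' in
    if j == 0%N then M 0%N *m cfgd_mx1 A eta gamma L 0 + M 1%N
    else if j == L then M 0%N *m cfgd_mx1 A eta gamma L L
    else M j.+1
  end.

End Recursion.

(* Main.v *)
(** On a coordinate line the objective is quadratic, with slope [G] and
    curvature [a] at [x], so its Caputo derivatives reduce to the integrals of
    [|t - x|^(-alpha)] and [|t - x|^(1 - alpha)] between [c] and [x].  The
    factors [Gamma (1 - alpha)] and [|x - c|^(1 - alpha)] cancel against the
    Caputo derivative of the identity, on either side of [c], and the direction
    is [G + gamma a (x - c)].  The error therefore obeys a linear recursion with
    delay [L]; unrolling it [k] times, from any starting index, gives the
    coefficients [calA k j].  For [j >= 1], [calA k j] is [calA k' 0] times a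
    fixed matrix for all large [k], with [k - k'] depending only on [j]; hence
    the limit. *)
Require Import Defs.
From HB Require Import structures.
From mathcomp Require Import all_boot all_order all_algebra.
From mathcomp Require Import all_classical all_reals all_analysis.
From mathcomp Require Import measurable_realfun.
From mathcomp Require Import ring lra.

Set Implicit Arguments.
Unset Strict Implicit.
Unset Printing Implicit Defensive.

Import Order.TTheory GRing.Theory Num.Theory.
Import numFieldNormedType.Exports.

Local Open Scope classical_set_scope.
Local Open Scope ring_scope.

(** * Integrals with endpoint singularities *)

Section ImproperIntegral.
Context {R : realType}.
Notation mu := (@lebesgue_measure R).

Lemma measurable_fun_itvcc_open (f : R -> R) (a b : R) :
  {in `]a, b[, continuous f} -> measurable_fun `[a, b] f.
Proof.
move=> cf.
apply: (@measurable_fun_itv_cc _ a b false true).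
apply: open_continuous_measurable_fun; first exact: interval_open.
by move=> x; rewrite inE; exact: cf.
Qed.

(** The integrand may blow up at either endpoint. The ordinary theorem applies on compact intervals
    [E n] exhausting []a, b[]; the integrals over them converge by monotone convergence, and the
    increments of [F] by its one-sided continuity at [a] and [b]. *)
Lemma ge0_improper_FTC2 (f F : R -> R) (a b : R) : a < b ->
  {in `]a, b[, forall x, 0 <= f x} -> {in `]a, b[, continuous f} ->
  derivable_oo_LRcontinuous F a b -> {in `]a, b[, F^`()%classic =1 f} ->
  (\int[mu]_(x in `[a, b]) (f x)%:E = (F b - F a)%:E)%E.
Proof.
move=> ab f0 cf [dF Fa Fb] F'f.
(* The denominator starts at 3 so that [E 0] is already nondegenerate. *)
pose e (n : nat) : R := (b - a) / n.+3%:R.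
have e0 n : 0 < e n by rewrite divr_gt0 ?subr_gt0.
have eab n : a + e n < b - e n.
  rewrite ltrBrDr -addrA -ltrBrDl -mulr2n -mulr_natr -mulrA gtr_pMr ?subr_gt0//.
  by rewrite mulrC ltr_pdivrMr// mul1r ltr_nat.
have e_cvg : e n @[n --> \oo] --> 0.
  rewrite -(mulr0 (b - a)); apply: cvgM; first exact: cvg_cst.
  have := @cvg_harmonic R; rewrite -(cvg_shiftn 2).
  by under eq_fun do rewrite /harmonic /= addn2.
pose E n := `[a + e n, b - e n]%classic.
have sE n : E n `<=` `]a, b[.
  move=> x; rewrite /E/= !in_itv/= => /andP[ax xb].
  by rewrite (lt_le_trans _ ax) ?ltrDl//= (le_lt_trans xb)// gtrDl oppr_lt0.
have bE : \bigcup_n E n = `]a, b[%classic.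
  apply/seteqP; split => [x [n _]|x]; first exact: sE.
  rewrite /= in_itv/= => /andP[ax xb].
  have : \forall n \near \oo, e n < Num.min (x - a) (b - x).
    by apply: (cvgr_lt 0 e_cvg); rewrite lt_min !subr_gt0 ax.
  case=> n _ /(_ n (leqnn n)); rewrite lt_min => /andP[h1 h2].
  by exists n => //; rewrite /E/= in_itv/=; apply/andP; split; lra.
have mf : measurable_fun `[a, b]%classic (EFin \o f).
  by apply/measurable_EFinP; exact: measurable_fun_itvcc_open.
have mfo : measurable_fun `]a, b[%classic (EFin \o f).
  by apply: measurable_funS mf => //; exact: subset_itv_oo_cc.
rewrite -integral_itv_bndo_bndc; last first.
  by apply: measurable_funS mf => //; apply: subset_itvl; rewrite bnd_simp.
rewrite -integral_itv_obnd_cbnd// -bE.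
have : (\int[mu]_(x in E n) (f x)%:E @[n --> \oo] -->
        \int[mu]_(x in \bigcup_n E n) (f x)%:E)%E.
  apply: ge0_nondecreasing_set_cvg_integral.
  - move=> m n mn; rewrite subsetEset; apply: subset_itv; rewrite bnd_simp.
      by rewrite lerD2l ler_pM2l ?subr_gt0// lef_pV2 ?posrE// ler_nat.
    by rewrite lerD2l lerN2 ler_pM2l ?subr_gt0// lef_pV2 ?posrE// ler_nat.
  - by move=> n; exact: measurable_itv.
  - by move=> n; apply: measurable_funS mfo => //; exact: sE.
  - by move=> n x /sE xab; rewrite lee_fin f0.
move=> /cvg_unique; apply; first exact: ereal_hausdorff.
have FE n : (\int[mu]_(x in E n) (f x)%:E = (F (b - e n) - F (a + e n))%:E)%E.
  have sE' : {subset `](a + e n), (b - e n)[%R <= `]a, b[%R}.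
    by move=> x /subset_itv_oo_cc /sE.
  rewrite (@continuous_FTC2 _ f F)//.
  - apply: continuous_in_subspaceT => x; rewrite inE => /sE; exact: cf.
  - have cF : {within `[a + e n, b - e n], continuous F}.
      by apply: derivable_within_continuous => x /sE; exact: dF.
    have /(continuous_within_itvP _ (eab n))[_ ? ?] := cF.
    by split => // x /sE'; exact: dF.
  - by move=> x /sE'; exact: F'f.
rewrite (funext FE); apply: cvg_EFin; first exact: nearW.
apply: cvgB.
- have /cvg_at_leftP := Fb; apply; split.
    by move=> n; rewrite gtrDl oppr_lt0.
  by rewrite -[X in _ --> X]subr0; apply: cvgB => //; exact: cvg_cst.
- have /cvg_at_rightP := Fa; apply; split.
    by move=> n; rewrite ltrDl.
  by rewrite -[X in _ --> X]addr0; apply: cvgD => //; exact: cvg_cst.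
Qed.

Lemma ge0_integrable_improper_FTC2 (f F : R -> R) (a b : R) : a < b ->
  (forall x, 0 <= f x) -> {in `]a, b[, continuous f} ->
  derivable_oo_LRcontinuous F a b -> {in `]a, b[, F^`()%classic =1 f} ->
  mu.-integrable `[a, b] (EFin \o f) /\
  \int[mu]_(x in `[a, b]) f x = F b - F a.
Proof.
move=> ab f0 cf dF F'f; have intf := ge0_improper_FTC2 ab (in1W f0) cf dF F'f.
split; last by rewrite /Rintegral intf.
apply/integrableP; split.
  by apply/measurable_EFinP; exact: measurable_fun_itvcc_open.
under eq_integral do rewrite /= ger0_norm//.
by rewrite intf ltry.
Qed.

Lemma is_derive1_powR_affine (s r q t : R) : 0 < s * t + r ->
  is_derive t 1 (fun t => (s * t + r) `^ q) (q * (s * t + r) `^ (q - 1) * s).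
Proof.
move=> h; have dl : is_derive t 1 (fun t => s * t + r) s.
  by apply: is_derive_eq; rewrite addr0 /GRing.scale/= mulr1.
exact: (@is_derive1_comp _ (fun y => y `^ q) (fun t => s * t + r) t _ _
         (is_derive1_powR q h) dl).
Qed.

(** For [p < 0] the integrand is singular at [a], but the primitive [F] remains continuous there
    because [p + 1 > 0]. *)
Lemma powR_subr_integral (a b p : R) : a < b -> -1 < p ->
  mu.-integrable `[a, b] (EFin \o (fun t => (t - a) `^ p)) /\
  \int[mu]_(t in `[a, b]) (t - a) `^ p = (b - a) `^ (p + 1) / (p + 1).
Proof.
move=> ab p1; have p0 : 0 < p + 1 by rewrite -ltrBlDr sub0r.
pose F (t : R) := (t - a) `^ (p + 1) / (p + 1).
have dk q t : a < t ->
    is_derive t 1 (fun t => (t - a) `^ q) (q * (t - a) `^ (q - 1)).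
  move=> at_; have := @is_derive1_powR_affine 1 (- a) q t.
  by rewrite mul1r mulr1; under eq_fun do rewrite mul1r; apply; rewrite subr_gt0.
have dF t : a < t -> is_derive t 1 F ((t - a) `^ p).
  move=> /(dk (p + 1)) dkt; rewrite /F; apply: is_derive_eq.
  rewrite scaler0 add0r /GRing.scale/= addrK mulrA mulVf ?mul1r//.
  exact: lt0r_neq0.
have [||||] := @ge0_integrable_improper_FTC2 (fun t => (t - a) `^ p) F a b ab.
- by move=> t; exact: powR_ge0.
- move=> t; rewrite in_itv/= => /andP[/(dk p) [/derivable1_diffP h _] _].
  exact: differentiable_continuous.
- split.
  + by move=> t; rewrite in_itv/= => /andP[/dF []].
  (* Right continuity at [a], tested on sequences: it reduces to the limit of [powR] at 0 from the
     right. *)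
  + rewrite /F subrr powR0 ?gt_eqF//; apply: cvgMr_tmp.
    apply/cvg_at_rightP => u [ua u_cvg].
    have /cvg_at_rightP := powR_cvg0 p0; apply; split.
      by move=> n; rewrite subr_gt0.
    by rewrite -(subrr a); apply: cvgB => //; exact: cvg_cst.
  + apply: cvg_at_left_filter; apply: differentiable_continuous.
    by apply/derivable1_diffP; have [] := dF _ ab.
- by move=> t; rewrite in_itv/= derive1E => /andP[/dF h _]; rewrite derive_val.
- by move=> i ->; split => //; rewrite /F subrr powR0 ?gt_eqF// mul0r subr0.
Qed.

(** Mirror image, with the singularity at [b]; the primitive changes sign. *)
Lemma powR_rsubr_integral (a b p : R) : a < b -> -1 < p ->
  mu.-integrable `[a, b] (EFin \o (fun t => (b - t) `^ p)) /\
  \int[mu]_(t in `[a, b]) (b - t) `^ p = (b - a) `^ (p + 1) / (p + 1).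
Proof.
move=> ab p1; have p0 : 0 < p + 1 by rewrite -ltrBlDr sub0r.
pose F (t : R) := - ((b - t) `^ (p + 1) / (p + 1)).
have dk q t : t < b ->
    is_derive t 1 (fun t => (b - t) `^ q) (- (q * (b - t) `^ (q - 1))).
  move=> tb; have := @is_derive1_powR_affine (-1) b q t.
  rewrite mulrN1 mulN1r [- t + b]addrC.
  by under eq_fun do rewrite mulN1r addrC; apply; rewrite subr_gt0.
have dF t : t < b -> is_derive t 1 F ((b - t) `^ p).
  move=> /(dk (p + 1)) dkt; rewrite /F; apply: is_derive_eq.
  rewrite scaler0 add0r /GRing.scale/= addrK mulrN opprK mulrA mulVf ?mul1r//.
  exact: lt0r_neq0.
have [||||] := @ge0_integrable_improper_FTC2 (fun t => (b - t) `^ p) F a b ab.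
- by move=> t; exact: powR_ge0.
- move=> t; rewrite in_itv/= => /andP[_ /(dk p) [/derivable1_diffP h _]].
  exact: differentiable_continuous.
- split.
  + by move=> t; rewrite in_itv/= => /andP[_ /dF []].
  + apply: cvg_at_right_filter; apply: differentiable_continuous.
    by apply/derivable1_diffP; have [] := dF _ ab.
  + rewrite /F subrr powR0 ?gt_eqF//; apply: cvgN; apply: cvgMr_tmp.
    apply/cvg_at_leftP => u [ub u_cvg].
    have /cvg_at_rightP := powR_cvg0 p0; apply; split.
      by move=> n; rewrite subr_gt0.
    by rewrite -(subrr b); apply: cvgB => //; exact: cvg_cst.
- by move=> t; rewrite in_itv/= derive1E => /andP[_ /dF h]; rewrite derive_val.
- move=> i ->; split => //.
  by rewrite /F subrr powR0 ?gt_eqF// mul0r oppr0 add0r opprK.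
Qed.

End ImproperIntegral.

(** * Positivity of Gamma on []0, 1]] *)

Section GammaPositive.
Context {R : realType}.
Notation mu := (@lebesgue_measure R).

(** As [z <= 1], the power is at least 1 on []0, 1]], so the integral over that interval alone is at
    least [expR (-1)]. Integrability comes first: a real-valued integral that diverges to infinity
    would take the value 0. *)
Lemma Gamma_gt0 (z : R) : 0 < z -> z <= 1 -> 0 < Gamma z.
Proof.
move=> z0 z1; pose f (t : R) := t `^ (z - 1) * expR (- t).
have f0 t : 0 <= f t by rewrite mulr_ge0 ?powR_ge0 ?expR_ge0.
have mf (D : set R) : measurable_fun D f.
  apply: (@measurable_funS _ _ _ _ setT) => //.
  apply: measurable_funM; first exact: measurable_powR.
  by apply: measurableT_comp => //; exact: measurable_expR.
have [int1 _] := @powR_subr_integral R 0 1 (z - 1) ltr01 ltac:(lra).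
have intf : mu.-integrable `]0, +oo[ (EFin \o f).
  (* Dominating function: the power on [[0, 1]], where the exponential is at most 1, plus the
     exponential density of rate 1, which suffices beyond 1, where the power is at most 1. *)
  pose h := (fun t : R => (t - 0) `^ (z - 1)) \_ `[0, 1].
  apply: (@le_integrable _ _ _ mu _ _ _ (EFin \o (h \+ exponential_pdf 1))).
  - exact: measurable_itv.
  - by apply/measurable_EFinP; exact: mf.
  - move=> t; rewrite /= in_itv/= andbT => t0; rewrite lee_fin.
    have h0 : 0 <= h t.
      by rewrite /h patchE; case: ifP => // _; exact: powR_ge0.
    rewrite !ger0_norm ?addr_ge0 ?exponential_pdf_ge0 ?ler01//.
    rewrite (exponential_pdfE 1 (ltW t0)) mul1r mulN1r.
    have e1 : expR (- t) <= 1 by rewrite -expR0 ler_expR oppr_le0 ltW.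
    have [t1|t1] := leP t 1.
      rewrite /h patchE mem_set/= ?in_itv/= ?(ltW t0)// subr0.
      by rewrite ler_wpDr ?expR_ge0// ler_piMr// powR_ge0.
    rewrite ler_wpDl// ler_piMl ?expR_ge0//.
    by rewrite -[leRHS](powRr0 t) ler_powR ?(ltW t1)// subr_le0.
  - apply: (@integrableS _ _ _ mu setT) => //.
    rewrite (_ : EFin \o _ = (EFin \o h) \+ (EFin \o exponential_pdf 1))//.
    apply: integrableD => //; last exact: integrable_exponential_pdf.
    by rewrite -restrict_EFin; apply/integrable_restrict => //=; rewrite setTI.
apply: lt_le_trans (_ : expR (-1) <= _); first exact: expR_gt0.
rewrite -lee_fin /Gamma /Rintegral fineK; last exact: integrable_fin_num.
have mfE (D : set R) : measurable_fun D (fun t => (f t)%:E).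
  by apply/measurable_EFinP; exact: mf.
apply: (@le_trans _ _ (\int[mu]_(t in `]0%R, 1%R]) (f t)%:E)%E); last first.
  apply: ge0_subset_integral => //; [exact: mfE| |exact: subset_itvl].
  by move=> t _; rewrite lee_fin.
rewrite (_ : (expR (-1))%:E = (\int[mu]_(t in `]0%R, 1%R]) (expR (-1))%:E)%E).
  apply: ge0_le_integral => //.
  - exact: mfE.
  - move=> t; rewrite /= in_itv/= => /andP[t0 t1]; rewrite lee_fin.
    rewrite -[leLHS]mul1r ler_pM ?expR_ge0//; last by rewrite ler_expR lerN2.
    by rewrite -[leLHS](powRr0 t) ger_powR ?t0// subr_le0.
rewrite integral_cst//= lebesgue_measure_itv/= lte_fin ltr01.
by rewrite sube0 mule1.
Qed.
End GammaPositive.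

(** * Linearity, and fractional integrals of affine functions *)

Lemma Rintegral_linear_comb d (T : measurableType d) (R : realType)
    (mu : {measure set T -> \bar R}) (D : set T) (p q : R) (f g : T -> R) :
  measurable D ->
  mu.-integrable D (EFin \o f) -> mu.-integrable D (EFin \o g) ->
  \int[mu]_(t in D) (p * f t + q * g t) =
  p * \int[mu]_(t in D) f t + q * \int[mu]_(t in D) g t.
Proof.
move=> mD intf intg.
rewrite RintegralD//; first by rewrite !RintegralZl.
- exact: (integrableZl mD p intf).
- exact: (integrableZl mD q intg).
Qed.

Section FractionalIntegral.
Context {R : realType}.
Notation mu := (@lebesgue_measure R).

(* At [h = 0] this holds by junk values: [0 `^ r = 0] for [r != 0] and [0^-1 = 0]. *)
Lemma affine_div_powR (alpha p q h : R) : alpha < 1 -> 0 <= h ->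
  (p + q * h) / h `^ alpha = p * h `^ (- alpha) + q * h `^ (1 - alpha).
Proof.
move=> alpha_lt1 h0; rewrite mulrDl powRN -mulrA; congr (_ + q * _).
have := @mulr_powRB1 _ h (1 - alpha) h0.
by rewrite subr_gt0 addrAC subrr add0r powRN; apply.
Qed.

(** Common core of the left and right cases: [u] stands for the distance to the singular endpoint,
    [t - a] or [b - t], and [h] for the length of the interval. *)
Lemma Rintegral_affine_div_powR (alpha p q : R) (u : R -> R)
    (h a b : R) : alpha < 1 -> 0 < h ->
  (forall t, t \in `[a, b] -> 0 <= u t) ->
  (forall r : R, -1 < r -> mu.-integrable `[a, b] (EFin \o (fun t => u t `^ r)) /\
     \int[mu]_(t in `[a, b]) u t `^ r = h `^ (r + 1) / (r + 1)) ->
  \int[mu]_(t in `[a, b]) ((p + q * u t) / u t `^ alpha) =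
  h `^ (1 - alpha) * (p / (1 - alpha) + q * h / (2 - alpha)).
Proof.
move=> alpha_lt1 h0 u0 uint.
have k1 : -1 < - alpha by lra.
have k2 : -1 < 1 - alpha by lra.
have [[i1 v1] [i2 v2]] := (uint _ k1, uint _ k2).
transitivity (\int[mu]_(t in `[a, b])
    (p * u t `^ (- alpha) + q * u t `^ (1 - alpha))).
  by apply: eq_Rintegral => t /[!inE] tab; rewrite affine_div_powR// u0.
rewrite (Rintegral_linear_comb p q _ i1 i2)// v1 v2.
rewrite (_ : h `^ (1 - alpha + 1) = h * h `^ (1 - alpha)); last first.
  rewrite powRD; last by rewrite (gt_eqF h0) implybT.
  by rewrite powRr1 1?mulrC// ltW.
rewrite (_ : - alpha + 1 = 1 - alpha) 1?addrC//.
by field; apply/andP; split; lra.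
Qed.

Lemma Rintegral_affine_subr (alpha p q a b : R) : alpha < 1 -> a < b ->
  \int[mu]_(t in `[a, b]) ((p + q * (t - a)) / (t - a) `^ alpha) =
  (b - a) `^ (1 - alpha) * (p / (1 - alpha) + q * (b - a) / (2 - alpha)).
Proof.
move=> alpha_lt1 ab; apply: Rintegral_affine_div_powR => //.
- by rewrite subr_gt0.
- by move=> t; rewrite in_itv/= subr_ge0 => /andP[].
- by move=> r; exact: powR_subr_integral.
Qed.

Lemma Rintegral_affine_rsubr (alpha p q a b : R) : alpha < 1 -> a < b ->
  \int[mu]_(t in `[a, b]) ((p + q * (b - t)) / (b - t) `^ alpha) =
  (b - a) `^ (1 - alpha) * (p / (1 - alpha) + q * (b - a) / (2 - alpha)).
Proof.
move=> alpha_lt1 ab; apply: Rintegral_affine_div_powR => //.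
- by rewrite subr_gt0.
- by move=> t; rewrite in_itv/= subr_ge0 => /andP[].
- by move=> r; exact: powR_rsubr_integral.
Qed.

End FractionalIntegral.

(** * Caputo derivatives of quadratic polynomials *)

Section CaputoQuadratic.
Context {R : realType}.

Lemma derive1_quadratic (P G a x : R) (g : R -> R)
    (gE : forall t, g t = P + G * (t - x) + a / 2 * (t - x) ^+ 2) :
  g^`()%classic = fun t => G + a * (t - x).
Proof.
apply/funext => t; rewrite (funext gE) derive1E.
apply: (@derive_val _ _ _ _ _ _ _ _).
apply: is_derive_eq; rewrite /GRing.scale/=.
by field.
Qed.

Lemma derive2_quadratic (P G a x : R) (g : R -> R)
    (gE : forall t, g t = P + G * (t - x) + a / 2 * (t - x) ^+ 2) :
  derive1n 2 g = fun=> a.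
Proof.
rewrite derive1nS derive1n1 (derive1_quadratic gE); apply/funext => t; rewrite derive1E.
apply: (@derive_val _ _ _ _ _ _ _ _).
by apply: is_derive_eq; rewrite /GRing.scale/=; ring.
Qed.

(** Here [n = 1]. The prefactor -1 of the right derivative becomes the sign of [x - c], and the
    slope in terms of the distance to [x] is [- a] on the left and [a] on the right, so one formula
    covers both sides. *)
Lemma caputo_quadratic (alpha P G a c x : R) (g : R -> R)
    (alpha_gt0 : 0 < alpha) (alpha_lt1 : alpha < 1)
    (gE : forall t, g t = P + G * (t - x) + a / 2 * (t - x) ^+ 2)
    (xc : x != c) :
  caputo alpha c g x =
  Num.sg (x - c) * (`|x - c| `^ (1 - alpha) / Gamma (1 - alpha)) *
  (G / (1 - alpha) - a * (x - c) / (2 - alpha)).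
Proof.
have tr0 : Num.truncn alpha = 0%N by apply/truncn_def; rewrite ltW.
rewrite /caputo tr0 derive1n1 (derive1_quadratic gE) subrK /= expr1.
have aN t : a * (t - x) = - a * (x - t) by ring.
case: ltgtP xc => // [cx|xc_] _.
  under eq_Rintegral do rewrite aN.
  by rewrite Rintegral_affine_rsubr// gtr0_sg ?gtr0_norm ?subr_gt0//; ring.
rewrite Rintegral_affine_subr// ltr0_sg ?ltr0_norm ?subr_lt0// opprB.
by ring.
Qed.

(** Now [n = 2]: the prefactor of the right derivative is 1, so no sign appears, and the kernel
    exponent is again [alpha]. *)
Lemma caputo_quadratic_succ (alpha P G a c x : R) (g : R -> R)
    (alpha_gt0 : 0 < alpha) (alpha_lt1 : alpha < 1)
    (gE : forall t, g t = P + G * (t - x) + a / 2 * (t - x) ^+ 2)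
    (xc : x != c) :
  caputo (1 + alpha) c g x =
  `|x - c| `^ (1 - alpha) / Gamma (1 - alpha) * (a / (1 - alpha)).
Proof.
have tr1 : Num.truncn (1 + alpha) = 1%N.
  by apply/truncn_def; apply/andP; split; lra.
rewrite /caputo tr1 (derive2_quadratic gE).
have -> : 2%:R - (1 + alpha) = 1 - alpha by ring.
have -> : 1 + alpha - 2%:R + 1 = alpha by ring.
(* The constant second derivative is read as an affine function of slope 0, to reuse the affine
   integrals. *)
have a0 u : a = a + 0 * u by rewrite mul0r addr0.
case: ltgtP xc => // [cx|xc_] _.
  under eq_Rintegral => t _ do rewrite [X in X / _](a0 (x - t)).
  by rewrite Rintegral_affine_rsubr// gtr0_norm ?subr_gt0// mul0r; ring.
under eq_Rintegral => t _ do rewrite [X in X / _](a0 (t - x)).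
by rewrite Rintegral_affine_subr// ltr0_norm ?subr_lt0// opprB mul0r; ring.
Qed.

End CaputoQuadratic.

(** * One coordinate of the descent direction *)

Section CfgdCoordinate.
Context {R : realType}.

Lemma caputo_id (alpha c x : R) (alpha_gt0 : 0 < alpha) (alpha_lt1 : alpha < 1)
    (xc : x != c) :
  caputo alpha c id x =
  Num.sg (x - c) * (`|x - c| `^ (1 - alpha) / Gamma (1 - alpha)) / (1 - alpha).
Proof.
rewrite (@caputo_quadratic _ alpha x 1 0 c x id)//; last by move=> t; field.
by rewrite !mul0r subr0 mul1r.
Qed.

Lemma caputo_id_neq0 (alpha c x : R) (alpha_gt0 : 0 < alpha) (alpha_lt1 : alpha < 1)
    (xc : x != c) :
  caputo alpha c id x != 0.
Proof.
rewrite caputo_id// !mulf_eq0 !invr_eq0 sgr_eq0 powR_eq0 normr_eq0 !subr_eq0.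
by rewrite (negbTE xc) /= gt_eqF ?Gamma_gt0 ?gt_eqF; lra.
Qed.

(** Once the common factor is cancelled, the order [alpha] term contributes
    [- (1 - alpha) / (2 - alpha)] to the coefficient of [a * (x - c)] and the order [1 + alpha] term
    contributes [beta]; their sum is [cfgd_gamma]. *)
Lemma cfgd_coordinate (alpha beta P G a c x : R) (g : R -> R)
    (alpha_gt0 : 0 < alpha) (alpha_lt1 : alpha < 1)
    (gE : forall t, g t = P + G * (t - x) + a / 2 * (t - x) ^+ 2)
    (xc : x != c) :
  (caputo alpha c id x)^-1 *
    (caputo alpha c g x + beta * (`|x - c| * caputo (1 + alpha) c g x)) =
  G + cfgd_gamma alpha beta * a * (x - c).
Proof.
have id0 := caputo_id_neq0 alpha_gt0 alpha_lt1 xc.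
apply: (mulfI id0); rewrite mulrA mulfV// mul1r.
rewrite caputo_id// (caputo_quadratic alpha_gt0 alpha_lt1 gE xc).
rewrite (caputo_quadratic_succ alpha_gt0 alpha_lt1 gE xc) /cfgd_gamma.
have G0 : Gamma (1 - alpha) != 0 by rewrite gt_eqF// Gamma_gt0; lra.
(* The weight supplies the sign that the derivative of order [1 + alpha] lacks. *)
have -> : `|x - c| = Num.sg (x - c) * (x - c) by exact: normrEsg.
field; rewrite G0/=; apply/andP; split; lra.
Qed.

End CfgdCoordinate.

(** * The direction for a quadratic objective *)

Section Direction.
Context {R : realType} {d : nat}.

(** Exact second-order Taylor expansion; symmetry of [A] makes the two cross terms equal, which
    yields the gradient [A *m x + b]. *)
Lemma coord_line_quadratic (A : 'M[R]_d) (b : 'cV[R]_d) (c0 : R) (j : 'I_d)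
    (x : 'cV[R]_d) (t : R) : A^T = A ->
  coord_line (quadratic A b c0) j x t =
  quadratic A b c0 x + (A *m x + b) j 0 * (t - x j 0) +
  A j j / 2 * (t - x j 0) ^+ 2.
Proof.
move=> AT; rewrite /coord_line /quadratic; set s := t - x j 0; set e := delta_mx j 0.
have eAx : (e^T *m A *m x) 0 0 = (A *m x) j 0.
  by rewrite -mulmxA trmx_delta -rowE mxE.
have xAe : (x^T *m A *m e) 0 0 = (A *m x) j 0.
  transitivity ((x^T *m A *m e)^T 0 0); first by rewrite [RHS]mxE.
  by rewrite !trmx_mul trmxK AT mulmxA eAx.
have eAe : (e^T *m A *m e) 0 0 = A j j.
  by rewrite -mulmxA -colE trmx_delta -rowE !mxE.
have be : (b^T *m e) 0 0 = b j 0 by rewrite -colE !mxE.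
have trE : (x + s *: e)^T = x^T + s *: e^T by rewrite linearD linearZ.
have -> : (x + s *: e)^T *m A *m (x + s *: e) = x^T *m A *m x +
    s *: (x^T *m A *m e) + s *: (e^T *m A *m x) + s ^+ 2 *: (e^T *m A *m e).
  rewrite trE mulmxDl mulmxDl mulmxDr mulmxDr -!scalemxAl -!scalemxAr scalerA.
  by rewrite expr2 !addrA.
have -> : b^T *m (x + s *: e) = b^T *m x + s *: (b^T *m e).
  by rewrite mulmxDr scalemxAr.
(* Generalising the products keeps [mxE] from unfolding them into sums. *)
move: (x^T *m A *m x) (x^T *m A *m e) (e^T *m A *m x) (e^T *m A *m e)
  (b^T *m x) (b^T *m e) (A *m x) eAx xAe eAe be.
by move=> M1 M2 M3 M4 M5 M6 M7; rewrite !mxE => -> -> -> ->; field.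
Qed.

Lemma mul_invmx_diag (r : 'rV[R]_d) (v : 'cV[R]_d) :
  (forall j, r 0 j != 0) ->
  invmx (diag_mx r) *m v = \col_j ((r 0 j)^-1 * v j 0).
Proof.
move=> r0; set w := \col_j _.
have -> : v = diag_mx r *m w.
  by apply/colP => j; rewrite mul_diag_mx !mxE mulrA mulfV ?mul1r.
by rewrite mulKmx// unitmxE det_diag unitfE prodf_seq_neq0; apply/allP => j _ /=.
Qed.

Lemma cfgd_dir_quadratic (A : 'M[R]_d) (b : 'cV[R]_d) (c0 alpha beta : R)
    (c x : 'cV[R]_d) :
  A^T = A -> 0 < alpha -> alpha < 1 -> (forall j, x j 0 != c j 0) ->
  cfgd_dir (quadratic A b c0) alpha beta c x =
  A *m x + b + cfgd_gamma alpha beta *: (diag_part A *m (x - c)).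
Proof.
move=> AT a0 a1 xc; rewrite /cfgd_dir mul_invmx_diag; last first.
  by move=> j; rewrite mxE caputo_id_neq0.
apply/colP => j.
have cE := cfgd_coordinate beta a0 a1 (fun t => coord_line_quadratic b c0 j x t AT) (xc j).
have addE (u v : 'cV[R]_d) : (u + v) j 0 = u j 0 + v j 0 by rewrite mxE.
have scaleE r (v : 'cV[R]_d) : (r *: v) j 0 = r * v j 0 by rewrite mxE.
have diagE (r : 'rV[R]_d) (v : 'cV[R]_d) : (diag_mx r *m v) j 0 = r 0 j * v j 0.
  by rewrite mul_diag_mx mxE.
rewrite [RHS]addE scaleE [diag_part A]/diag_part diagE (addE x) mulrA.
rewrite [(- c) j 0]mxE.
have -> : (\row_i A i i) 0 j = A j j by exact: mxE.
rewrite -cE [LHS]mxE (addE _ (beta *: _)) scaleE diagE.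
by congr (_^-1 * (_ + beta * (_ * _))); exact: mxE.
Qed.
End Direction.

(** * Euclidean and spectral norms *)

Section EuclideanNorm.
Context {R : realType} {d : nat}.
Implicit Types (u v : 'cV[R]_d) (M : 'M[R]_d).

Lemma enorm_ge0 v : 0 <= enorm v.
Proof. exact: sqrtr_ge0. Qed.

Lemma sqr_enorm v : enorm v ^+ 2 = \sum_i v i 0 ^+ 2.
Proof. by rewrite sqr_sqrtr// sumr_ge0// => i _; rewrite sqr_ge0. Qed.

Lemma enorm0 : enorm (0 : 'cV[R]_d) = 0.
Proof. by rewrite /enorm big1 ?sqrtr0// => i _; rewrite mxE expr0n. Qed.

Lemma enorm0_eq0 v : enorm v = 0 -> v = 0.
Proof.
move=> v0; have /eqP : enorm v ^+ 2 = 0 by rewrite v0 expr0n.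
rewrite sqr_enorm psumr_eq0; last by move=> i _; rewrite sqr_ge0.
move=> /allP h; apply/colP => i; rewrite mxE.
by apply/eqP; rewrite -sqrf_eq0; apply: h; rewrite mem_index_enum.
Qed.

Lemma enormZ (a : R) v : enorm (a *: v) = `|a| * enorm v.
Proof.
rewrite /enorm -sqrtr_sqr -sqrtrM ?sqr_ge0// mulr_sumr.
by congr Num.sqrt; apply: eq_bigr => i _; rewrite mxE exprMn.
Qed.

(** Cauchy-Schwarz: with [a] and [b] the two norms, the sum of the squares of
    [b * u i 0 - a * v i 0] is [2 * (a * b)] times the defect in the inequality. Zero norms are
    treated apart so that this factor is positive. *)
Lemma sum_mul_le_enorm u v : \sum_i u i 0 * v i 0 <= enorm u * enorm v.
Proof.
have [u0|u0] := eqVneq (enorm u) 0.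
  by rewrite u0 mul0r (enorm0_eq0 u0) big1// => i _; rewrite mxE mul0r.
have [v0|v0] := eqVneq (enorm v) 0.
  by rewrite v0 mulr0 (enorm0_eq0 v0) big1// => i _; rewrite mxE mulr0.
have up : 0 < enorm u by rewrite lt_def u0 enorm_ge0.
have vp : 0 < enorm v by rewrite lt_def v0 enorm_ge0.
set a := enorm u; set b := enorm v.
have : 0 <= \sum_i (b * u i 0 - a * v i 0) ^+ 2.
  by apply: sumr_ge0 => i _; exact: sqr_ge0.
have -> : \sum_i (b * u i 0 - a * v i 0) ^+ 2 =
    2 * (a * b) * (a * b - \sum_i u i 0 * v i 0).
  transitivity (b ^+ 2 * \sum_i u i 0 ^+ 2 + a ^+ 2 * \sum_i v i 0 ^+ 2
                - 2 * (a * b) * \sum_i u i 0 * v i 0).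
    rewrite !mulr_sumr -big_split -sumrB/=.
    by apply: eq_bigr => i _; ring.
  by rewrite -!sqr_enorm -/a -/b; ring.
by rewrite pmulr_rge0 ?subr_ge0// !mulr_gt0.
Qed.

Lemma enormD u v : enorm (u + v) <= enorm u + enorm v.
Proof.
rewrite -(@ler_pXn2r _ 2) ?nnegrE ?addr_ge0 ?enorm_ge0// sqrrD !sqr_enorm.
have -> : \sum_i (u + v) i 0 ^+ 2 =
    \sum_i u i 0 ^+ 2 + (\sum_i u i 0 * v i 0) *+ 2 + \sum_i v i 0 ^+ 2.
  rewrite -sumrMnl -!big_split/=.
  by apply: eq_bigr => i _; rewrite mxE sqrrD.
by rewrite lerD2r lerD2l lerMn2r/= sum_mul_le_enorm.
Qed.

Lemma enorm_sum (I : finType) (F : I -> 'cV[R]_d) :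
  enorm (\sum_i F i) <= \sum_i enorm (F i).
Proof.
elim/big_ind2 : _ => // [|x1 x2 y1 y2 h1 h2]; first by rewrite enorm0.
by apply: le_trans (enormD _ _) _; exact: lerD.
Qed.

Lemma normr_le_enorm v i : `|v i 0| <= enorm v.
Proof.
rewrite -sqrtr_sqr ler_wsqrtr// (bigD1 i)//= lerDl sumr_ge0// => j _.
exact: sqr_ge0.
Qed.

(** Makes the supremum in [spectral_norm] a genuine one. Entries of a vector in the unit ball are at
    most 1 in absolute value, so the column norms add up to an upper bound. *)
Lemma spectral_norm_has_sup M :
  has_sup [set enorm (M *m v) | v in [set v : 'cV[R]_d | enorm v <= 1]].
Proof.
split; first by exists (enorm (M *m 0)), 0 => //=; rewrite enorm0 ler01.
exists (\sum_j enorm (col j M)) => _ [v /= v1 <-].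
have -> : M *m v = \sum_j v j 0 *: col j M.
  by apply/colP => i; rewrite mxE summxE; apply: eq_bigr => j _; rewrite !mxE mulrC.
apply: le_trans (enorm_sum _) _.
apply: ler_sum => j _; rewrite enormZ ler_piMl ?enorm_ge0//.
exact: le_trans (normr_le_enorm _ _) v1.
Qed.

Lemma enorm_mulmx_le M v : enorm (M *m v) <= spectral_norm M * enorm v.
Proof.
have [v0|v0] := eqVneq (enorm v) 0.
  by rewrite v0 mulr0 (enorm0_eq0 v0) mulmx0 enorm0.
have vp : 0 < enorm v by rewrite lt_def v0 enorm_ge0.
rewrite -ler_pdivrMr//; apply: ub_le_sup; first by case: (spectral_norm_has_sup M).
exists ((enorm v)^-1 *: v); rewrite /= ?enormZ.
  by rewrite ger0_norm ?invr_ge0 ?enorm_ge0// mulVf.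
by rewrite -scalemxAr enormZ ger0_norm ?invr_ge0 ?enorm_ge0// mulrC.
Qed.

End EuclideanNorm.

(** A nonzero row [r] of the left kernel would make the quadratic form vanish at [r^T]. *)
Lemma sym_posdef_unitmx {R : realType} {d : nat} (A : 'M[R]_d) :
  sym_posdef A -> A \in unitmx.
Proof.
move=> [_ A_pos]; rewrite -row_free_unit -kermx_eq0.
apply/eqP/row_matrixP => i; rewrite row0; set r := row i (kermx A).
have rA : r *m A = 0 by rewrite -row_mul mulmx_ker row0.
apply/eqP/negPn/negP => r0.
have := A_pos r^T; rewrite trmxK rA mul0mx mxE ltxx trmx_eq0 => /(_ r0).
by [].
Qed.

(** * The linear recursion with delay *)

Section Recursion.
Context {R : realType} {d : nat}.
Implicit Types (A : 'M[R]_d) (eta gamma : R) (L : nat).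

#[local] Arguments cfgd_mx : simpl never.

Lemma cfgd_mxE A eta gamma L k j :
  cfgd_mx A eta gamma L k.+2 j =
  let M := cfgd_mx A eta gamma L k.+1 in
    if j == 0%N then M 0%N *m cfgd_mx1 A eta gamma L 0 + M 1%N
    else if j == L then M 0%N *m cfgd_mx1 A eta gamma L L
    else M j.+1.
Proof. by []. Qed.

(** The start [m] is kept general because the induction on [k] uses the expansion from [m.+1]. There
    only the newest error, at [j = 0], is expanded by one step; the other terms shift by one index,
    exactly as the matrices do. *)
Lemma cfgd_mx_expansion A eta gamma L (e : int -> 'cV[R]_d) :
  (1 <= L)%N ->
  (forall m : nat, e m.+1%:Z =
     cfgd_mx1 A eta gamma L 0 *m e m%:Z +
     cfgd_mx1 A eta gamma L L *m e (m%:Z - L%:Z)) ->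
  forall k m : nat, e (m + k.+1)%N%:Z =
    \sum_(j < L.+1) cfgd_mx A eta gamma L k.+1 j *m e (m%:Z - j%:Z).
Proof.
case: L => // L' _ eS; elim=> [|k IH] m.
  rewrite addn1 eS big_ord_recl/= subr0; congr (_ + _).
  rewrite big_ord_recr/= big1 ?add0r// => i _.
  by rewrite /cfgd_mx/= /cfgd_mx1 /= eqSS (ltn_eqF (ltn_ord i)) mul0mx.
rewrite -addSnnS IH big_ord_recl [RHS]big_ord_recl/= !subr0 eS.
(* The old term [j = 1] joins the new [j = 0], the delayed part of the expanded term becomes the new
   [j = L], and the rest match after the shift. *)
rewrite big_ord_recl [X in _ = _ + X]big_ord_recr !cfgd_mxE/= eqxx.
have -> : m.+1%:Z - 1 = m%:Z by rewrite -addn1 PoszD addrK.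
rewrite mulmxDl mulmxDr !mulmxA -!addrA; congr (_ + _).
rewrite addrC -!addrA; congr (_ + _); congr (_ + _).
apply: eq_bigr => i _; rewrite cfgd_mxE /= eqSS (ltn_eqF (ltn_ord i)).
by congr (_ *m e _); rewrite /bump/= !add1n -!natr1; ring.
Qed.

(** Induction on [L - j]. Stating the limit for products with a vector lets the fixed matrix
    occurring at [j = L] be absorbed into that vector. *)
Lemma cfgd_mx_cvg0 A eta gamma L (v : 'cV[R]_d) (j : nat) : (j <= L)%N ->
  spectral_norm (cfgd_mx A eta gamma L k 0%N) @[k --> \oo] --> (0 : R) ->
  enorm (cfgd_mx A eta gamma L k j *m v) @[k --> \oo] --> (0 : R).
Proof.
move=> + M0; have M0v w : enorm (cfgd_mx A eta gamma L k 0%N *m w) @[k --> \oo] --> (0 : R).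
  apply: (@squeeze_cvgr _ _ _ _ (cst 0)
    (fun k => spectral_norm (cfgd_mx A eta gamma L k 0%N) * enorm w)).
  - by apply: nearW => k; rewrite enorm_ge0 enorm_mulmx_le.
  - exact: cvg_cst.
  - by rewrite -(mul0r (enorm w)); apply: cvgMr_tmp.
case: j => [_|j]; first exact: M0v.
move: {2}(L - j.+1)%N (erefl (L - j.+1)%N) => i.
elim: i j => [|i IH] j ji jL.
  have jE : j.+1 = L by apply/eqP; rewrite eqn_leq jL -subn_eq0 ji.
  have := M0v (cfgd_mx1 A eta gamma L L *m v).
  (* The matrix recursion holds only from index 2 on, so the sequences are compared at [k + 1] and
     [k + 2]. *)
  rewrite -(cvg_shiftn 1) -[X in _ -> X](cvg_shiftn 2)/=.
  apply: cvg_trans; apply: near_eq_cvg; apply: nearW => k /=.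
  by rewrite addn1 addn2 cfgd_mxE/= jE eqxx mulmxA.
have jL' : (j.+1 < L)%N by rewrite -subn_gt0 ji.
have := IH j.+1; rewrite subnS ji => /(_ erefl jL').
rewrite -(cvg_shiftn 1) -[X in _ -> X](cvg_shiftn 2)/=.
apply: cvg_trans; apply: near_eq_cvg; apply: nearW => k /=.
by rewrite addn1 addn2 cfgd_mxE/= (ltn_eqF jL').
Qed.
End Recursion.

(** * Error bound and convergence of the iteration *)

Theorem theorem3p3 (R : realType) (d : nat) (A : 'M[R]_d) (b : 'cV[R]_d)
    (c alpha beta eta : R) (L : nat) (x : int -> 'cV[R]_d)
    (A_spd : sym_posdef A)
    (alpha_gt0 : 0 < alpha) (alpha_lt1 : alpha < 1)
    (L_ge1 : (1 <= L)%N) (eta_gt0 : 0 < eta)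
    (x_cfgd : cfgd (quadratic A b c) (fun=> alpha) (fun=> beta) (fun=> eta)
                (fun k => x (k%:Z - L%:Z)) x)
    (x_wd : cfgd_well_defined (fun k => x (k%:Z - L%:Z)) x) :
  let xstar := - (invmx A *m b) in
  let calA := cfgd_mx A eta (cfgd_gamma alpha beta) L in
  (forall k : nat, (1 <= k)%N ->
     enorm (x k%:Z - xstar) <=
     \sum_(j < L.+1) spectral_norm (calA k j) * enorm (x (- j%:Z) - xstar)) /\
  (spectral_norm (calA k 0%N) @[k --> \oo] --> (0 : R) ->
   enorm (x k%:Z - xstar) @[k --> \oo] --> (0 : R)).
Proof.
move=> xstar calA; pose e (n : int) := x n - xstar.
have A_unit := sym_posdef_unitmx A_spd.
have [A_sym _] := A_spd.
have Axstar : A *m xstar = - b by rewrite mulmxN mulKVmx.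
(* As [A *m xstar = - b], the gradient at an iterate is [A] times the error, and [xstar] cancels in
   the difference between an iterate and its terminal. *)
have eS (m : nat) : e m.+1%:Z =
    cfgd_mx1 A eta (cfgd_gamma alpha beta) L 0 *m e m%:Z +
    cfgd_mx1 A eta (cfgd_gamma alpha beta) L L *m e (m%:Z - L%:Z).
  have xm : x m%:Z = e m%:Z + xstar by rewrite subrK.
  have xB : x m%:Z - x (m%:Z - L%:Z) = e m%:Z - e (m%:Z - L%:Z).
    by rewrite /e opprB addrA subrK.
  have grad : A *m x m%:Z + b = A *m e m%:Z.
    by rewrite xm mulmxDr Axstar subrK.
  rewrite {1}/e x_cfgd cfgd_dir_quadratic// grad xB xm.
  rewrite [diag_part A *m _]mulmxBr /cfgd_mx1 !eqxx gtn_eqF//.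
  rewrite mulmxBl mul1mx -!scalemxAl mulmxDl -scalemxAl.
  move: (A *m e m%:Z) (diag_part A *m e m%:Z) (diag_part A *m e _) => Ae De De'.
  by apply/colP => i; rewrite !mxE; ring.
have e_sum (k : nat) : (1 <= k)%N ->
    e k%:Z = \sum_(j < L.+1) calA k j *m e (- j%:Z).
  case: k => // k _; rewrite -[k.+1]add0n (cfgd_mx_expansion L_ge1 eS).
  by apply: eq_bigr => j _; rewrite sub0r.
split=> [k k1|calA0].
  rewrite -/(e _) e_sum//; apply: le_trans (enorm_sum _) _.
  by apply: ler_sum => j _; exact: enorm_mulmx_le.
(* The bound keeps the initial errors inside the norms, where each of the finitely many terms tends
   to 0. *)
apply: (@squeeze_cvgr _ _ _ _ (cst 0)
  (fun k => \sum_(j < L.+1) enorm (calA k j *m e (- j%:Z)))).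
(* Only eventual, since the expansion fails to apply at the dummy index [k = 0]. *)
- near=> k; rewrite enorm_ge0/= -/(e _) e_sum ?enorm_sum//.
  by near: k; exact: nbhs_infty_ge.
- exact: cvg_cst.
- rewrite [X in _ --> X](_ : 0 = \sum_(j < L.+1) (0 : R)); last by rewrite big1.
  apply: cvg_big => [|j _]; first exact: add_continuous.
  apply: cfgd_mx_cvg0 => //.
  by rewrite -ltnS.
Unshelve. all: by end_near. Qed.
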